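(* Let $\mathcal{P}\mathcal{T}\colon\mathcal{X}\to\mathcal{Z}$ have the singular-value decomposition $$\mathcal{P}\mathcal{T}F=\sum_{k\in\kappa}\tau_k\langle F,g_k\rangle_{\mathcal{X}}\,h_k,\quad F\in\mathcal{X},$$ where $\kappa\subset\mathbb{N}$, $\tau_k>0$, $(g_k)_{k\in\kappa}$ is an orthonormal basis of $(\ker\mathcal{P}\mathcal{T})^{\perp}\subset\mathcal{X}$ and $(h_k)_{k\in\kappa}$, $h_k=\tau_k^{-1}\mathcal{P}\mathcal{T}g_k$, is an orthonormal system in $\mathcal{Z}$. Let the family of functions $\varphi_J\colon[0,\infty)\to[0,\infty)$, $J\in\mathbb{N}_0$, satisfy the following conditions: (i) for all $J\in\mathbb{N}_0$ and all $x\in X$, $\ \sum_{k\in\kappa}\left|\varphi_J(k)\,\overline{g_k(x)}\,\tau_k^{-1}\right|^2<+\infty$; (ii) for all $J\in\mathbb{N}_0$, $\ \sup_{k\in\kappa}\left(\varphi_J(k)\,\tau_k^{-1}\right)<+\infty$; (iii) for all $k\in\kappa$, $\ \lim_{J\to\infty}\varphi_J(k)=1$; (iv) for all $J\in\mathbb{N}_0$ and all $k\in\kappa$, $\ 0\leq\varphi_J(k)\leq 1$. For $G\in\mathcal{Z}$ and $J\in\mathbb{N}_0$ define $\Phi_J\ast G\in\mathcal{X}$ by $$(\Phi_J\ast G)(x):=\left\langle G,\ \sum_{k\in\kappa}\varphi_J(k)\,\tau_k^{-1}\,\overline{g_k(x)}\,h_k\right\rangle_{\mathcal{Z}},\quad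 x\in X.$$ Then $$\lim_{J\to\infty}\left\|(\mathcal{P}\mathcal{T})^{+}G-\Phi_J\ast G\right\|_{\mathcal{X}}=0\quad\text{for all }G\in\operatorname{im}(\mathcal{P}\mathcal{T}).$$ Moreover, for each $J\in\mathbb{N}_0$, the mapping $\mathcal{Z}\to\mathcal{X}$, $G\mapsto\Phi_J\ast G$, is continuous.
   Context: $\mathcal{X},\mathcal{Y},\mathcal{Z}$ are non-trivial (complex) Hilbert spaces of functions with domains $X,Y,Z$, respectively; inner products are linear in the first argument. As usual, the spaces may consist of almost-everywhere equivalence classes (e.g. $L^2$ spaces), in which case representatives of the $g_k$ are fixed. Convention: if a series of elements of $\mathcal{X}$ converges both in $\|\cdot\|_{\mathcal{X}}$ and pointwise at every $x\in X$, then the pointwise sum is identified with (represents) the norm limit; this holds, for instance, for $L^2$ spaces and for Hilbert spaces with continuous point evaluations. $\iota\colon\mathcal{Z}\hookrightarrow\mathcal{Y}$ is a linear isometric embedding, $\mathcal{P}\colon\mathcal{Y}\to\mathcal{Z}$ is a continuous linear projection, meaning $\mathcal{P}(\iota(\mathcal{P}G))=\mathcal{P}G$ for all $G\in\mathcal{Y}$ and $\mathcal{P}\circ\iota=\mathrm{Id}_{\mathcal{Z}}$, and $\mathcal{T}\colon\mathcal{X}\to\mathcal{Y}$ is a compact linear operator. Hence $\mathcal{P}\mathcal{T}$ is compact; $\kappa$ is the (finite or countably infinite) index set of its nonzero singular values. $(\mathcal{P}\mathcal{T})^{+}=\left(\mathcal{P}\mathcal{T}|_{(\ker(\mathcal{P}\mathcal{T}))^{\perp}}\right)^{-1}$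 denotes the Moore–Penrose inverse: for $G\in\operatorname{im}(\mathcal{P}\mathcal{T})$, $(\mathcal{P}\mathcal{T})^{+}G$ is the unique $F\in(\ker\mathcal{P}\mathcal{T})^{\perp}$ with $\mathcal{P}\mathcal{T}F=G$. $\mathbb{N}$ is the set of positive integers and $\mathbb{N}_0=\mathbb{N}\cup\{0\}$. The series in the definition of $\Phi_J\ast G$ is understood as a norm-convergent series in $\mathcal{Z}$ for each fixed $x$. *)

(* Defs.v *)
From HB Require Import structures.
From mathcomp Require Import all_boot all_order all_algebra.
From mathcomp Require Import complex sesquilinear.
From mathcomp Require Import all_classical all_reals all_analysis.

Set Implicit Arguments.
Unset Strict Implicit.
Unset Printing Implicit Defensive.

Import Order.TTheory GRing.Theory Num.Theory.
Import numFieldNormedType.Exports.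

Local Open Scope classical_set_scope.
Local Open Scope complex_scope.
Local Open Scope ring_scope.

(* The topology of the complex plane is only available on the alias [R[i]^o],
   hence the [^o] below wherever a limit of complex numbers is taken. *)

(* Complex Hilbert spaces. [inner] is linear in its first argument and
   conjugate-linear in the second one. *)
HB.mixin Record CompleteNormedModule_isHilbert (R : realType) H
    of CompleteNormedModule R[i] H := {
  inner : {dot H for @Num.conj R[i]} ;
  inner_norm : forall u : H, inner u u = `|u| ^+ 2
}.

#[short(type="hilbertType")]
HB.structure Definition Hilbert (R : realType) :=
  {H of CompleteNormedModule_isHilbert R H & CompleteNormedModule R[i] H}.

(* A Hilbert space [H] "of functions with domain [D]": [represents F f] means
   that the function [f] is the element [F], or is a member of [F] when the
   elements of [H] are almost-everywhere classes; so [F] need not determine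
   [f], but [f] determines [F]. *)
Record function_space (R : realType) (H : hilbertType R) (D : Type) :=
  FunctionSpace {
  represents : H -> (D -> R[i]) -> Prop ;
  represents_exists : forall F, exists f, represents F f ;
  represents_unique : forall F G f,
    represents F f -> represents G f -> F = G ;
  represents_linear : forall (a : R[i]) F G f g,
    represents F f -> represents G g ->
    represents (a *: F + G) (fun x => a * f x + g x)
}.

(* A series that converges both in norm and at every point has its pointwise
   sum as a representative of its norm limit. *)
Definition pointwise_sum_convention (R : realType) (H : hilbertType R)
    (D : Type) (S : function_space H D) : Prop :=
  forall (u : nat -> H) (f : nat -> D -> R[i]) (F : H) (s : D -> R[i]),
    (forall n, represents S (u n) (f n)) ->
    series u @ \oo --> F ->
    (forall x, series (fun n => f n x : R[i]^o) @ \oo --> (s x : R[i]^o)) ->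
    represents S F s.

(* Junk value 0 when [f] represents no element. *)
Definition represented (R : realType) (H : hilbertType R) (D : Type)
    (S : function_space H D) (f : D -> R[i]) : H :=
  xget 0 [set F | represents S F f].

Definition compact_operator (R : realType) (H K : hilbertType R)
    (A : H -> K) : Prop :=
  forall B : set H, bounded_set B -> precompact (A @` B).

Definition operator_kernel (R : realType) (H K : hilbertType R) (A : H -> K) :
    set H :=
  [set F | A F = 0].

Definition orthogonal_complement (R : realType) (H : hilbertType R)
    (M : set H) : set H :=
  [set F | forall G, M G -> inner F G = 0].

(* Partial sums of a series over [kappa], taken in increasing order. *)
Definition series_in (V : zmodType) (kappa : set nat) (u : nat -> V) :
    nat -> V :=
  fun n => \sum_(0 <= k < n | k \in kappa) u k.

Definition orthonormal_system (R : realType) (H : hilbertType R)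
    (kappa : set nat) (e : nat -> H) : Prop :=
  forall j k, kappa j -> kappa k -> inner (e j) (e k) = (j == k)%:R.

(* The closed linear span of the system is [M]. *)
Definition orthonormal_basis (R : realType) (H : hilbertType R)
    (kappa : set nat) (e : nat -> H) (M : set H) : Prop :=
  orthonormal_system kappa e /\
  closure [set v : H | exists (a : nat -> R[i]) (n : nat),
             v = series_in kappa (fun k => a k *: e k) n] = M.

Definition is_svd (R : realType) (H K : hilbertType R) (A : H -> K)
    (kappa : set nat) (tau : nat -> R) (g : nat -> H) (h : nat -> K) : Prop :=
  [/\ forall k, kappa k -> 0 < tau k,
      orthonormal_basis kappa g (orthogonal_complement (operator_kernel A)),
      orthonormal_system kappa h,
      forall k, kappa k -> h k = ((tau k)^-1)%:C *: A (g k) &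
      forall F, series_in kappa (fun k => ((tau k)%:C * inner F (g k)) *: h k)
                  @ \oo --> A F].

(* Junk value 0 when [G] is not in the range of [A]. *)
Definition moore_penrose (R : realType) (H K : hilbertType R) (A : H -> K)
    (G : K) : H :=
  xget 0 [set F | orthogonal_complement (operator_kernel A) F /\ A F = G].

(* The series, in [K], that is paired with [G] in the definition of Phi_J * G:
   [f] is phi_J, and [g k] is the chosen representative of the k-th right
   singular vector. [filter_conv_fun] is Phi_J * G as a function on [D], and
   [filter_conv] is the element of [H] that this function represents. *)
Definition filter_series (R : realType) (K : hilbertType R) (D : Type)
    (kappa : set nat) (tau : nat -> R) (g : nat -> D -> R[i]) (h : nat -> K)
    (f : R -> R) (x : D) : nat -> K :=
  series_in kappa (fun k => ((f k%:R * (tau k)^-1)%:C * (g k x)^*) *: h k).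

Definition filter_conv_fun (R : realType) (K : hilbertType R) (D : Type)
    (kappa : set nat) (tau : nat -> R) (g : nat -> D -> R[i]) (h : nat -> K)
    (f : R -> R) (G : K) : D -> R[i] :=
  fun x => inner G (lim (filter_series kappa tau g h f x @ \oo)).

Definition filter_conv (R : realType) (H K : hilbertType R) (D : Type)
    (S : function_space H D)
    (kappa : set nat) (tau : nat -> R) (g : nat -> D -> R[i]) (h : nat -> K)
    (f : R -> R) (G : K) : H :=
  represented S (filter_conv_fun kappa tau g h f G).

(* Main.v *)
(* On the range of A, the coefficients of G = A F along h_k are tau_k <F, g_k>,
   so the coefficients of Phi_J * G along g_k are phi_J(k) <F, g_k>, where F is
   the Moore-Penrose preimage. Hence the error has coefficients
   (1 - phi_J(k)) <F, g_k>: its tail is dominated by that of the convergent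
   series of the |<F, g_k>|^2, uniformly in J, and each of the remaining
   finitely many coefficients tends to 0. Continuity of Phi_J * _ is Bessel's
   inequality for (h_k) together with the bound on phi_J(k) / tau_k. *)

Require Import Defs.
From HB Require Import structures.
From mathcomp Require Import all_boot all_order all_algebra.
From mathcomp Require Import complex sesquilinear.
From mathcomp Require Import all_classical all_reals all_analysis.
Set Implicit Arguments.
Unset Strict Implicit.
Unset Printing Implicit Defensive.
Import Order.TTheory GRing.Theory Num.Theory.
Import numFieldNormedType.Exports.
Local Open Scope classical_set_scope.
Local Open Scope complex_scope.
Local Open Scope ring_scope.

(** * Cauchy-Schwarz and continuity of the inner product *)

Section InnerProduct.
Variables (R : realType) (H : hilbertType R).
Implicit Types (u v w : H) (a : R[i]).

Lemma inner_conj u v : inner u v = (inner v u)^*.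
Proof. by rewrite (hermC inner u v) mul1r. Qed.

Lemma innerZl a u v : inner (a *: u) v = a * inner u v.
Proof. exact: (linearZl_LR inner v a u). Qed.

Lemma innerZr a u v : inner u (a *: v) = a^* * inner u v.
Proof. exact: (linearZr_LR inner u a v). Qed.

Lemma norm_sqrD_orthogonal u v :
  inner u v = 0 -> `|u + v| ^+ 2 = `|u| ^+ 2 + `|v| ^+ 2.
Proof. by move=> uv; rewrite -!inner_norm hnormDd. Qed.

(** Cauchy-Schwarz: [a *: v] is the orthogonal projection of [u] onto the line of [v], and
    Pythagoras for [u = (u - a *: v) + a *: v] bounds its norm by that of [u]. *)
Lemma inner_norm_le u v : `|inner u v| <= `|u| * `|v|.
Proof.
have [->|v0] := eqVneq v 0; first by rewrite linear0r !normr0 mulr0.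
have vv : `|v| ^+ 2 != 0 by rewrite expf_neq0 ?normr_eq0.
pose a := inner u v / `|v| ^+ 2.
have o : inner (u - a *: v) (a *: v) = 0.
  by rewrite innerZr linearBl /= innerZl inner_norm /a divfK// subrr mulr0.
have := norm_sqrD_orthogonal o; rewrite subrK => e.
rewrite -(@ler_pXn2r _ 2) ?nnegrE ?mulr_ge0// exprMn e mulrDl.
rewrite normrZ /a normrM normfV normrX normr_id.
rewrite -[leLHS]add0r lerD ?mulr_ge0 ?exprn_ge0//.
move: vv; set n := `|v| ^+ 2 => vv.
rewrite exprMn -/n exprMn exprVn (expr2 n) invfM.
by rewrite [X in X * n * n]mulrA !mulfVK.
Qed.

Lemma cvg_innerl (T : Type) (F : set_system T) {FF : Filter F}
    (f : T -> H) u v :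
  f x @[x --> F] --> u ->
  (inner (f x) v : R[i]^o) @[x --> F] --> (inner u v : R[i]^o).
Proof.
move=> fu; apply/cvgrPdist_lt => e e0.
(* Adding 1 keeps the divisor positive when [v] is 0. *)
have v1 : 0 < `|v| + 1 by rewrite ltr_wpDl.
move/cvgrPdist_lt : fu => /(_ (e / (`|v| + 1)) (divr_gt0 e0 v1)).
apply: filterS => x; rewrite ltr_pdivlMr// => xe.
rewrite -linearBl (le_lt_trans (inner_norm_le _ _))// (le_lt_trans _ xe)//.
by rewrite ler_wpM2l// lerDl.
Qed.

Lemma cvg_innerr (T : Type) (F : set_system T) {FF : Filter F}
    (f : T -> H) u v :
  f x @[x --> F] --> u ->
  (inner v (f x) : R[i]^o) @[x --> F] --> (inner v u : R[i]^o).
Proof.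
move=> fu; apply/cvgrPdist_lt => e e0.
have /cvgrPdist_lt/(_ e e0) := @cvg_innerl _ _ FF _ _ v fu.
apply: filterS => x.
by rewrite -norm_conjC rmorphB /= -!inner_conj.
Qed.

Lemma cvg_norm_le (T : Type) (F : set_system T) {FF : ProperFilter F}
    (f : T -> H) u (c : R[i]) :
  f x @[x --> F] --> u -> (\forall x \near F, `|f x| <= c) -> `|u| <= c.
Proof.
move=> fu fc; apply/ler_addgt0Pl => e e0.
move/cvgrPdist_lt : fu => /(_ e e0) fu.
have [x [ux xc]] := filter_ex (filterI fu fc).
by rewrite -(subrK (f x) u) (le_trans (ler_normD _ _))// lerD// ltW.
Qed.

End InnerProduct.

(** Norms take values in [R[i]]; this is the passage to real numbers, where monotone convergence is
    available. *)
Lemma normc_normE (R : realType) (V : normedModType R[i]) (v : V) :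
  `|v| = (Normc.normc `|v|)%:C.
Proof. by rewrite -[LHS]normr_id. Qed.

(** * Orthonormal series: Bessel, Riesz-Fischer, and convergence of filtered expansions *)

Section OrthonormalSeries.
Variables (R : realType) (H : hilbertType R) (kappa : set nat) (e : nat -> H).
Hypothesis oe : orthonormal_system kappa e.
Implicit Types (a b : nat -> R[i]) (s : seq nat) (F : H).

Local Notation nsq z := (Normc.normc z ^+ 2).
Local Notation osum b := (series_in kappa (fun k => b k *: e k)).

Lemma series_inE (V : zmodType) (u : nat -> V) :
  series_in kappa u = [series if k \in kappa then u k else 0]_k.
Proof. by apply/funext => n; rewrite /series_in /series /= big_mkcond. Qed.

Lemma inner_orthonormal_sum s b j : uniq s -> kappa j ->
  inner (\sum_(k <- s | k \in kappa) b k *: e k) (e j) =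
  if j \in s then b j else 0.
Proof.
move=> us kj; rewrite linear_sumlz.
have bE k : k \in kappa -> inner (b k *: e k) (e j) = if k == j then b k else 0.
  rewrite inE => kk; rewrite innerZl oe//.
  by case: eqP => _; rewrite ?mulr1 ?mulr0.
rewrite (eq_bigr _ bE) -big_mkcondr/=; case: ifPn => js.
  rewrite big_mkcond (bigD1_seq j)//= mem_set// eqxx big1 ?addr0//.
  by move=> k /negPf kj'; rewrite kj' andbF.
rewrite big_seq_cond big1// => k /andP[ks /andP[_ /eqP kE]].
by rewrite -kE ks in js.
Qed.

(** Pythagoras, by induction on [s]. An arbitrary duplicate-free list covers both partial sums and
    the blocks of the Cauchy criterion. *)
Lemma norm_orthonormal_sum s b : uniq s ->
  `|\sum_(k <- s | k \in kappa) b k *: e k| ^+ 2 =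
  (\sum_(k <- s | k \in kappa) nsq (b k))%:C.
Proof.
elim: s => [|j s IH] /=; first by rewrite !big_nil normr0 expr0n.
move=> /andP[js us]; rewrite !big_cons; case: ifPn => kj; last exact: IH.
have {}kj : kappa j by rewrite inE in kj.
rewrite norm_sqrD_orthogonal ?IH//; last first.
  rewrite innerZl inner_conj inner_orthonormal_sum// (negPf js).
  by rewrite rmorph0 mulr0.
rewrite normrZ exprMn -[`|e j| ^+ 2]inner_norm oe// eqxx mulr1.
by rewrite rmorphD rmorphXn.
Qed.

(** The partial sum is orthogonal to the remainder, so Pythagoras applies. *)
Lemma bessel F n :
  \sum_(0 <= k < n | k \in kappa) nsq (inner F (e k)) <= nsq `|F|.
Proof.
set b := fun k => inner F (e k).
have o : inner (F - osum b n) (osum b n) = 0.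
  rewrite {2}/series_in linear_sumr big_seq_cond big1// => k /andP[kn kk].
  have {}kk : kappa k by rewrite inE in kk.
  rewrite /= innerZr linearBl /= inner_orthonormal_sum ?iota_uniq// kn.
  by rewrite subrr mulr0.
rewrite -lecR rmorphXn /= -normc_normE -[in leRHS](subrK (osum b n) F).
rewrite norm_sqrD_orthogonal// norm_orthonormal_sum ?iota_uniq//.
by rewrite lerDr exprn_ge0.
Qed.

(** The partial sums are nondecreasing and bounded, hence convergent, hence Cauchy. *)
Lemma summable_tail (q : nat -> R) (M : R) :
  (forall k, 0 <= q k) ->
  (forall n, \sum_(0 <= k < n | k \in kappa) q k <= M) ->
  forall eps, 0 < eps ->
    exists N, forall m n, (N <= m)%N ->
      \sum_(m <= k < n | k \in kappa) q k < eps.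
Proof.
move=> q0 qM eps eps0.
have cq : cvgn (series_in kappa q).
  apply: nondecreasing_is_cvgn; last by exists M => _ [n _ <-]; exact: qM.
  by apply: nondecreasing_series.
have : cauchy (series_in kappa q @ \oo) by exact: cvg_cauchy.
rewrite series_inE => /cauchy_seriesP/(_ _ eps0)[[A B]].
move=> [[N1 _ A1] [N2 _ B1] AB].
exists (maxn N1 N2) => m n; rewrite geq_max => /andP[m1 m2].
have [nm|mn] := leqP n m; first by rewrite big_geq.
have := AB (m, n); rewrite /= -big_mkcond => ABmn.
apply: (le_lt_trans (ler_norm _)); apply: ABmn.
split; [exact: A1 | apply: B1 => /=; exact: leq_trans m2 (ltnW mn)].
Qed.

(** Riesz-Fischer: the squared norms of blocks are blocks of a summable real series, and the space
    is complete. *)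
Lemma cvg_orthonormal_series b (M : R) :
  (forall n, \sum_(0 <= k < n | k \in kappa) nsq (b k) <= M) ->
  cvgn (osum b).
Proof.
move=> bM; apply: cauchy_cvg; rewrite series_inE.
apply/cauchy_seriesP => eps eps0.
(* Positivity in [R[i]] forces a zero imaginary part, so [eps] is a real [r]. *)
have [r r0 epsE] : exists2 r : R, 0 < r & eps = r%:C.
  exists (complex.Re eps); last by rewrite RRe_real// gtr0_real.
  by move: eps0; rewrite ltcE => /andP[].
have [N NP] :=
  summable_tail (fun k => sqr_ge0 (Normc.normc (b k))) bM (exprn_gt0 2 r0).
exists ([set n | (N <= n)%N], setT) => /=.
  by split; [exists N|exact: filterT].
move=> [m n] /= [Nm _]; rewrite -big_mkcond.
rewrite -(@ltr_pXn2r _ 2) ?nnegrE ?(ltW eps0)//.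
rewrite norm_orthonormal_sum ?iota_uniq//.
by rewrite epsE -rmorphXn /= ltcR NP.
Qed.

Lemma norm_orthonormal_series b F (M : R) : osum b @ \oo --> F -> 0 <= M ->
  (forall n, \sum_(0 <= k < n | k \in kappa) nsq (b k) <= M ^+ 2) ->
  `|F| <= M%:C.
Proof.
move=> bF M0 bM; apply: (cvg_norm_le bF); apply: nearW => n.
rewrite -(@ler_pXn2r _ 2) ?nnegrE ?ler0c// norm_orthonormal_sum ?iota_uniq//.
by rewrite -rmorphXn /= lecR.
Qed.

(** Pairing with [e j] is continuous, and on partial sums it is constant once [j] is included. *)
Lemma inner_orthonormal_series b F j : osum b @ \oo --> F -> kappa j ->
  inner F (e j) = b j.
Proof.
move=> bF kj; have bFj : (inner (osum b n) (e j) : R[i]^o) @[n --> \oo] -->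
  (inner F (e j) : R[i]^o) by exact: cvg_innerl.
have bj : (inner (osum b n) (e j) : R[i]^o) @[n --> \oo] --> (b j : R[i]^o).
  apply: cvg_near_cst; exists j.+1 => // n /= jn.
  by rewrite /series_in inner_orthonormal_sum ?iota_uniq// mem_index_iota jn.
exact: (cvg_unique (@norm_hausdorff _ R[i]^o) bFj bj).
Qed.

(** The error is itself the sum of an orthonormal series, with coefficients [w J], so bounding the
    sums of their squares bounds its norm. *)
Lemma cvg_orthonormal_filter a F (M : R) (p : nat -> nat -> R) (FJ : nat -> H) :
  (forall n, \sum_(0 <= k < n | k \in kappa) nsq (a k) <= M) ->
  osum a @ \oo --> F ->
  (forall J k, kappa k -> 0 <= p J k <= 1) ->
  (forall k, kappa k -> p J k @[J --> \oo] --> (1 : R)) ->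
  (forall J, osum (fun k => (p J k)%:C * a k) @ \oo --> FJ J) ->
  (`|F - FJ J| : R[i]^o) @[J --> \oo] --> (0 : R[i]^o).
Proof.
move=> aM aF p01 p1 pF.
pose w J k := (1 - p J k)%:C * a k.
have wE J k : nsq (w J k) = (1 - p J k) ^+ 2 * nsq (a k).
  rewrite Normc.normcM exprMn; congr (_ * _).
  by rewrite /Normc.normc /= expr0n addr0 sqr_sqrtr ?sqr_ge0.
have wa J k : kappa k -> nsq (w J k) <= nsq (a k).
  move=> kk; rewrite wE ler_piMl ?sqr_ge0// expr_le1//.
    by rewrite lerBlDr lerDl; case/andP : (p01 J k kk).
  by rewrite subr_ge0; case/andP : (p01 J k kk).
have wF J : osum (w J) @ \oo --> F - FJ J.
  have -> : osum (w J) = (fun n =>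
      osum a n - osum (fun k => (p J k)%:C * a k) n).
    apply/funext => n; rewrite /series_in -sumrB; apply: eq_bigr => k _.
    by rewrite -scalerBl /w rmorphB rmorph1 mulrBl mul1r.
  exact: cvgB.
have head s : \sum_(k <- s | k \in kappa) nsq (w J k) @[J --> \oo] --> (0 : R).
  elim: s => [|k s IH].
    by under eq_fun do rewrite big_nil; exact: cvg_cst.
  under eq_fun do rewrite big_cons.
  case: (boolP (k \in kappa)) => [kk|_]; last exact: IH.
  have {}kk : kappa k by rewrite inE in kk.
  suff wk : nsq (w J k) @[J --> \oo] --> (0 : R).
    have := cvgD wk IH; rewrite addr0; exact.
  under eq_fun do rewrite wE expr2.
  have p0 : 1 - p J k @[J --> \oo] --> (0 : R).
    by rewrite -(subrr 1); apply: cvgB (p1 _ kk); exact: cvg_cst.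
  rewrite -(mul0r (nsq (a k))) -[X in X * _](mulr0 0).
  by apply: cvgM; [exact: cvgM | exact: cvg_cst].
apply/cvgrPdist_lt => eps eps0.
have [r r0 ->] : exists2 r : R, 0 < r & eps = r%:C.
  exists (complex.Re eps); last by rewrite RRe_real// gtr0_real.
  by move: eps0; rewrite ltcE => /andP[].
(* Head and tail each receive [d], together [(r / 2) ^+ 2]; aiming at [r / 2] restores the strict
   inequality that is lost in the limit. *)
pose d := (r / 2) ^+ 2 / 2.
have d0 : 0 < d by rewrite divr_gt0// exprn_gt0// divr_gt0.
have [N NP] := summable_tail (fun k => sqr_ge0 (Normc.normc (a k))) aM d0.
move/cvgrPdist_lt : (head (index_iota 0 N)) => /(_ d d0); apply: filterS => J.
rewrite !sub0r !normrN => /(le_lt_trans (ler_norm _)) wd.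
rewrite normr_id; apply: (@le_lt_trans _ _ (r / 2)%:C); last first.
  by rewrite ltcR ltr_pdivrMr// ltr_pMr// ltr1n.
apply: (norm_orthonormal_series (wF J)) => [|n].
  by rewrite divr_ge0// ltW.
(* Extending the sum to [maxn N n] only increases it and allows a split at [N]. *)
have nN : (n <= maxn N n)%N by rewrite leq_maxr.
apply: (le_trans (nondecreasing_series (u_ := fun k => nsq (w J k)) _ nN)).
  by move=> k _ _; exact: sqr_ge0.
rewrite (@big_cat_nat _ _ _ N)//= ?leq_maxl// [leRHS]splitr lerD// ?(ltW wd)//.
rewrite (le_trans _ (ltW (NP N (maxn N n) _)))//.
by apply: ler_sum => k; rewrite inE; exact: wa.
Qed.

End OrthonormalSeries.

(** * Kernel, orthogonal projection and Moore-Penrose inverse from the singular system *)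

Section SingularValueDecomposition.
Variables (R : realType) (H K : hilbertType R) (A : {linear H -> K}).
Variables (kappa : set nat) (tau : nat -> R) (g : nat -> H) (h : nat -> K).
Hypothesis svdA : is_svd A kappa tau g h.

Lemma svd_orthonormal_right : orthonormal_system kappa g.
Proof. by case: svdA => _ []. Qed.

Lemma svd_orthonormal_left : orthonormal_system kappa h.
Proof. by case: svdA. Qed.

Lemma svd_inner_left F k : kappa k ->
  inner (A F) (h k) = (tau k)%:C * inner F (g k).
Proof.
move=> kk; case: svdA => _ _ oh _ /(_ F) AF.
by rewrite (inner_orthonormal_series oh AF).
Qed.

Lemma svd_kernel_complement_right k : kappa k ->
  orthogonal_complement (operator_kernel A) (g k).
Proof.
move=> kk; case: svdA => _ [_ <-] _ _ _; apply: subset_closure.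
(* The bound is [k.+1] because partial sums exclude their upper index. *)
exists (fun j => (j == k)%:R), k.+1.
rewrite /series_in big_mkcond big_nat_recr//= mem_set// eqxx scale1r.
rewrite big_nat_cond big1 ?add0r// => j /andP[/andP[_ jk] _].
by rewrite (ltn_eqF jk) scale0r if_same.
Qed.

Lemma svd_orthogonal_kernel D :
  (forall k, kappa k -> inner D (g k) = 0) -> A D = 0.
Proof.
move=> Dg; case: svdA => _ _ _ _ /(_ D) AD.
rewrite -(cvg_lim _ AD)//; apply/cvg_lim => //.
rewrite (_ : series_in _ _ = fun=> 0); first exact: cvg_cst.
apply/funext => n; apply: big1 => k; rewrite inE => /Dg ->.
by rewrite mulr0 scale0r.
Qed.

(** The sum of the Bessel series inherits orthogonality to the kernel from its partial sums, and
    differs from [F] by a vector orthogonal to every [g k], which [A] sends to 0. *)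
Lemma svd_projection F : exists F',
  [/\ series_in kappa (fun k => inner F (g k) *: g k) @ \oo --> F',
      orthogonal_complement (operator_kernel A) F' & A F' = A F].
Proof.
have og := svd_orthonormal_right.
have /cvg_ex[F' FF'] := cvg_orthonormal_series og (bessel og F).
exists F'; split => //.
- move=> D AD.
  have /cvg_lim <-// :
      (inner (series_in kappa (fun k => inner F (g k) *: g k) n) D : R[i]^o)
      @[n --> \oo] --> (inner F' D : R[i]^o) by exact: cvg_innerl.
  apply/cvg_lim => //; under eq_fun; last exact: cvg_cst.
  move=> n; rewrite /series_in linear_sumlz big1 ?over// => k.
  by rewrite inE => kk /=; rewrite innerZl svd_kernel_complement_right// mulr0.
- apply/eqP; rewrite -subr_eq0 -linearB; apply/eqP.
  apply: svd_orthogonal_kernel => k kk.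
  by rewrite linearBl /= (inner_orthonormal_series og FF')// subrr.
Qed.

(* F and the sum of its expansion are both in the orthogonal complement of the
   kernel and have the same image, so they differ by an element of the kernel
   orthogonal to itself. *)
Lemma svd_expansion F : orthogonal_complement (operator_kernel A) F ->
  series_in kappa (fun k => inner F (g k) *: g k) @ \oo --> F.
Proof.
move=> Fo; have [F' [FF' F'o AF']] := svd_projection F.
suff FE : F' = F by move: FF'; rewrite FE.
have kerD : operator_kernel A (F - F').
  by rewrite /operator_kernel /= linearB AF' subrr.
apply/esym/eqP; rewrite -subr_eq0 -normr_eq0 -sqrf_eq0 -inner_norm linearBl /=.
by rewrite Fo// F'o// subrr.
Qed.

Lemma moore_penroseP G : range A G ->
  orthogonal_complement (operator_kernel A) (moore_penrose A G) /\
  A (moore_penrose A G) = G.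
Proof.
move=> [F _ <-]; have [F' [_ F'o AF']] := svd_projection F.
rewrite /moore_penrose; set P := [set F | _].
(* The projection inhabits [P], so [xget] does not fall back on its default 0. *)
by have : P (xget 0 P) by apply: xgetPex; exists F'.
Qed.

End SingularValueDecomposition.

(** * Elements and their representing functions *)

Lemma represents0 (R : realType) (H : hilbertType R) (D : Type)
  (S : function_space H D) : represents S 0 (fun=> 0).
Proof.
have [f f0] := represents_exists S 0.
(* Any representative [f] of 0 yields the zero function as [- f + f]. *)
have := represents_linear (-1) f0 f0.
rewrite scaler0 addr0; congr represents.
by apply/funext => x; rewrite mulN1r addNr.
Qed.

Lemma representedE (R : realType) (H : hilbertType R) (D : Type)
  (S : function_space H D) F f : represents S F f -> represented S f = F.
Proof.
move=> Ff; apply: (represents_unique _ Ff).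
rewrite /represented; set P := [set F | _].
by have : P (xget 0 P) by apply: xgetPex; exists F.
Qed.

(** * The filtered inverse for one fixed filter function *)

Section FilterConvolution.
Variables (R : realType) (H K : hilbertType R) (D : Type).
Variables (S : function_space H D) (kappa : set nat) (tau : nat -> R).
Variables (g : nat -> H) (gfun : nat -> D -> R[i]) (h : nat -> K) (f : R -> R).
Hypothesis S_series : pointwise_sum_convention S.
Hypothesis og : orthonormal_system kappa g.
Hypothesis oh : orthonormal_system kappa h.
Hypothesis g_gfun : forall k, kappa k -> represents S (g k) (gfun k).
Hypothesis f_summable : forall x,
  (\esum_(k in kappa)
     (Normc.normc ((f k%:R)%:C * (gfun k x)^* * ((tau k)^-1)%:C) ^+ 2)%:E
     < +oo)%E.
Variable C : R.
Hypothesis f_bounded : forall k, kappa k -> 0 <= f k%:R * (tau k)^-1 <= C.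

Local Notation fc := (filter_conv S kappa tau gfun h f).
Local Notation fcfun := (filter_conv_fun kappa tau gfun h f).
Local Notation coef G k := ((f k%:R * (tau k)^-1)%:C * inner G (h k)).

(** Condition (i) is square summability of the coefficients along [h], so Riesz-Fischer applies. *)
Lemma cvg_filter_series x : cvgn (filter_series kappa tau gfun h f x).
Proof.
set q := fun k => Normc.normc ((f k%:R * (tau k)^-1)%:C * (gfun k x)^*) ^+ 2.
have qE k :
    Normc.normc ((f k%:R)%:C * (gfun k x)^* * ((tau k)^-1)%:C) ^+ 2 = q k.
  by rewrite /q rmorphM/= mulrAC.
have := f_summable x; under eq_esum do rewrite qE.
rewrite -[X in esum X]set_mem_set -nneseries_esum => [qoo|k _]; last first.
  by rewrite lee_fin sqr_ge0.
set s := (X in (X < _)%E) in qoo.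
have sn n : ((\sum_(0 <= k < n | k \in kappa) q k)%:E <= s)%E.
  by rewrite -sumEFin nneseries_lim_ge// => k _ _; rewrite lee_fin sqr_ge0.
apply: (cvg_orthonormal_series oh (M := fine s)) => n.
(* [s] dominates the empty sum 0, so being below [+oo] makes it finite. *)
rewrite -lee_fin fineK// ge0_fin_numE// (le_trans _ (sn 0%N))//.
by rewrite big_geq.
Qed.

Lemma sum_coef_le G n :
  \sum_(0 <= k < n | k \in kappa) Normc.normc (coef G k) ^+ 2 <=
  (C * Normc.normc `|G|) ^+ 2.
Proof.
rewrite exprMn (le_trans _ (ler_wpM2l (sqr_ge0 C) (bessel oh G n)))//.
rewrite mulr_sumr; apply: ler_sum => k; rewrite inE => /f_bounded/andP[c0 cC].
rewrite Normc.normcM exprMn ler_wpM2r ?sqr_ge0//.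
rewrite /Normc.normc /= expr0n addr0 sqr_sqrtr ?sqr_ge0//.
by rewrite lerXn2r ?nnegrE// (le_trans c0).
Qed.

(** The series along [g] converges in norm by Riesz-Fischer, and pointwise to the pairing that
    defines the convolution; the pointwise-sum convention identifies both limits. *)
Lemma represents_filter_conv G :
  represents S (fc G) (fcfun G) /\
  series_in kappa (fun k => coef G k *: g k) @ \oo --> fc G.
Proof.
have /cvg_ex[F GF] := cvg_orthonormal_series og (sum_coef_le G).
suff FG : represents S F (fcfun G).
  by rewrite /filter_conv (representedE FG).
(* The convention concerns series over all of [nat], hence the padding by 0 outside [kappa]. *)
apply: (S_series (u := fun k => if k \in kappa then coef G k *: g k else 0)
  (f := fun k x => if k \in kappa then coef G k * gfun k x else 0)).
- move=> k; case: ifPn => [|_]; last exact: represents0.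
  rewrite inE => kk.
  have := represents_linear (coef G k) (g_gfun kk) (represents0 S).
  by rewrite addr0; congr represents; apply/funext => x; rewrite addr0.
- by rewrite -series_inE.
- move=> x; rewrite -series_inE.
  rewrite (_ : series_in _ _ = fun n =>
    (inner G (filter_series kappa tau gfun h f x n) : R[i]^o)).
    by apply: cvg_innerr; exact: cvg_filter_series.
  apply/funext => n; apply/esym.
  (* Conjugate-linearity in the second argument undoes the conjugation of [gfun k x]. *)
  rewrite /filter_series /series_in linear_sumr; apply: eq_bigr => k _ /=.
  rewrite innerZr rmorphM /= conjCK mulrAC; congr (_ * _ * _).
  exact: conjc_real.
Qed.

(** The coefficients are linear in [G], so the difference is the series of [G - G'], to which
    [sum_coef_le] applies. *)
Lemma filter_conv_lipschitz (C0 : 0 <= C) G G' :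
  `|fc G - fc G'| <= C%:C * `|G - G'|.
Proof.
have [_ Gs] := represents_filter_conv G.
have [_ G's] := represents_filter_conv G'.
have s : series_in kappa (fun k => coef (G - G') k *: g k) @ \oo -->
    fc G - fc G'.
  rewrite (_ : series_in _ _ = fun n =>
    series_in kappa (fun k => coef G k *: g k) n -
    series_in kappa (fun k => coef G' k *: g k) n); first exact: cvgB.
  apply/funext => n; rewrite /series_in -sumrB; apply: eq_bigr => k _.
  by rewrite linearBl /= mulrBr scalerBl.
rewrite [in leRHS]normc_normE -rmorphM.
apply: (norm_orthonormal_series og s); last exact: sum_coef_le.
by rewrite mulr_ge0// -ler0c -normc_normE.
Qed.

Lemma continuous_filter_conv (C0 : 0 <= C) : continuous fc.
Proof.
move=> G; apply/cvgrPdist_lt => eps eps0.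
have C1 : 0 < C%:C + 1 :> R[i] by rewrite ltr_wpDl ?ler0c.
have /cvgrPdist_lt : id G' @[G' --> G] --> G by exact: cvg_id.
move=> /(_ (eps / (C%:C + 1)) (divr_gt0 eps0 C1)); apply: filterS => G'.
rewrite ltr_pdivlMr// => GG'.
apply: le_lt_trans (filter_conv_lipschitz C0 G G') _.
by rewrite (le_lt_trans _ GG')// mulrC ler_wpM2l// lerDl.
Qed.

End FilterConvolution.

Theorem theorem8p1 (R : realType) (HX HY HZ : hilbertType R) (X Y Z : Type)
    (SX : function_space HX X) (SY : function_space HY Y)
    (SZ : function_space HZ Z)
    (HX_nontrivial : exists F : HX, F != 0)
    (HY_nontrivial : exists G : HY, G != 0)
    (HZ_nontrivial : exists G : HZ, G != 0)
    (SX_series : pointwise_sum_convention SX)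
    (iota : {linear HZ -> HY}) (iota_isometry : forall G, `|iota G| = `|G|)
    (P : {linear HY -> HZ}) (P_continuous : continuous P)
    (P_projection : forall G, P (iota (P G)) = P G)
    (P_iota : forall G, P (iota G) = G)
    (T : {linear HX -> HY}) (T_compact : compact_operator T)
    (kappa : set nat) (kappa_pos : forall k, kappa k -> (0 < k)%N)
    (tau : nat -> R) (g : nat -> HX) (h : nat -> HZ)
    (PT_svd : is_svd (P \o T) kappa tau g h)
    (gfun : nat -> X -> R[i])
    (g_gfun : forall k, kappa k -> represents SX (g k) (gfun k))
    (phi : nat -> R -> R)
    (phi_ge0 : forall J (t : R), 0 <= t -> 0 <= phi J t)
    (cond_i : forall J x,
      (\esum_(k in kappa)
         (Normc.normc ((phi J k%:R)%:C * (gfun k x)^* * ((tau k)^-1)%:C)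
            ^+ 2)%:E < +oo)%E)
    (cond_ii : forall J,
      (ereal_sup [set (phi J k%:R * (tau k)^-1)%:E | k in kappa] < +oo)%E)
    (cond_iii : forall k, kappa k -> phi J k%:R @[J --> \oo] --> (1 : R))
    (cond_iv : forall J k, kappa k -> 0 <= phi J k%:R <= 1) :
  [/\ forall J x, cvgn (filter_series kappa tau gfun h (phi J) x),
      forall J G, represents SX (filter_conv SX kappa tau gfun h (phi J) G)
                                (filter_conv_fun kappa tau gfun h (phi J) G),
      forall G, range (P \o T) G ->
        (`|moore_penrose (P \o T) G - filter_conv SX kappa tau gfun h (phi J) G|
           : R[i]^o) @[J --> \oo] --> (0 : R[i]^o) &
      forall J, continuous (filter_conv SX kappa tau gfun h (phi J))].
Proof.
have og := svd_orthonormal_right PT_svd.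
have oh := svd_orthonormal_left PT_svd.
have tau_gt0 : forall k, kappa k -> 0 < tau k by case: PT_svd.
(* The constant is the supremum in [cond_ii]; the maximum with 0 gives nonnegativity even for empty
   [kappa], where the bound is vacuous. *)
have [C C0 phiC] : exists2 C : nat -> R, forall J, 0 <= C J &
    forall J k, kappa k -> 0 <= phi J k%:R * (tau k)^-1 <= C J.
  exists (fun J => Num.max 0 (fine (ereal_sup
    [set (phi J k%:R * (tau k)^-1)%:E | k in kappa]))) => [J|J k kk].
    by rewrite le_max lexx.
  have := cond_ii J; set s := ereal_sup _ => soo.
  have ks : ((phi J k%:R * (tau k)^-1)%:E <= s)%E.
    by apply: ereal_sup_ubound; exists k.
  have p0 : 0 <= phi J k%:R * (tau k)^-1.
    by case/andP: (cond_iv J k kk) => p0 _; rewrite divr_ge0// ltW// tau_gt0.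
  rewrite p0 le_max; apply/orP; right.
  rewrite -lee_fin fineK// fin_numElt soo andbT (lt_le_trans _ ks)//.
  by rewrite ltNyr.
have conv J G := represents_filter_conv SX_series og oh g_gfun
  (cond_i J) (phiC J) G.
split.
- move=> J; exact: cvg_filter_series.
- by move=> J G; case: (conv J G).
- move=> G /(moore_penroseP PT_svd)[Fo AF].
  set F := moore_penrose _ G in Fo AF *.
  apply: (cvg_orthonormal_filter og (bessel og F) (svd_expansion PT_svd Fo)
    cond_iv cond_iii) => J.
  have [_] := conv J G.
  rewrite (_ : series_in _ _ = series_in kappa
    (fun k => ((phi J k%:R)%:C * inner F (g k)) *: g k))//.
  apply/funext => n; apply: eq_bigr => k; rewrite inE => kk.
  (* The factor [tau k] of the coefficient of [G] cancels the inverse in the filter. *)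
  rewrite -AF (svd_inner_left PT_svd)// mulrA -rmorphM/= mulfVK//.
  by rewrite gt_eqF// tau_gt0.
- move=> J; exact: (continuous_filter_conv SX_series og oh g_gfun
    (cond_i J) (phiC J)).
Qed.
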